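(* Let $\Phi$ be a root system in a finite-dimensional real Euclidean space $V$, with finite reflection group $W$, fixed simple system $\Pi$ and simple reflections $S$, and let $n\ge1$. With $\mathcal{I}^{(n)}$, $\mathcal{X}_{\mathbf{I}}$, $\mathcal{C}^{(n)}=\mathcal{C}^{(n)}_W$ and strata as defined in the context: (a) If $\mathbf{I}\in\mathcal{I}^{(n)}$, then $\mathcal{X}_{\mathbf{I}}\subseteq\mathcal{C}^{(n)}$. (b) If $\mathbf{I}=(I_0,\dots,I_n)\in\mathcal{I}^{(n)}$, $w\in W$ and $\mathbf{v}\in w(\mathcal{X}_{\mathbf{I}})$, then $\operatorname{Stab}_W(\mathbf{v})=wW_{I_n}w^{-1}$. (c) Let $v,w\in W$ and $\mathbf{I},\mathbf{J}\in\mathcal{I}^{(n)}$. The following are equivalent: (i) $v(\mathcal{X}_{\mathbf{I}})\cap w(\mathcal{X}_{\mathbf{J}})\neq\emptyset$; (ii) $v(\mathcal{X}_{\mathbf{I}})=w(\mathcal{X}_{\mathbf{J}})$; (iii) $\mathbf{I}=\mathbf{J}$ and $v^{-1}w\in W_{I_n}$. (d) If $\mathbf{I}\in\mathcal{I}^{(n)}$ and $w\in W$, then the setwise stabiliser $\operatorname{Stab}_W(w(\mathcal{X}_{\mathbf{I}}))$ equals $wW_{I_n}w^{-1}$. (e) The sets $\mathcal{C}^{(n)}$ and $V^n$ are the disjoint unions of the strata they contain. (f) The topological closure of any stratum of $V^n$ is a union of strata.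
   Context: $V$ is a finite-dimensional real vector space with inner product $\langle-,-\rangle$. For $0\ne\alpha\in V$ put $\alpha^\vee=2\alpha/\langle\alpha,\alpha\rangle$ and $s_\alpha(v)=v-\langle v,\alpha^\vee\rangle\alpha$. A root system $\Phi$ in $V$ is a finite subset of $V\setminus\{0\}$ such that $s_\alpha(\beta)\in\Phi$ for all $\alpha,\beta\in\Phi$, and such that $\alpha,c\alpha\in\Phi$ with $c\in\mathbb{R}$ implies $c\in\{\pm1\}$ (it need not span $V$ or be crystallographic). $W$ is the finite group generated by $\{s_\alpha\mid\alpha\in\Phi\}$. A simple system $\Pi\subseteq\Phi$ is a linearly independent subset such that $\Phi=\Phi_+\sqcup(-\Phi_+)$, where $\Phi_+=\Phi\cap\mathbb{R}_{\ge0}\Pi$; one is fixed. $S=\{s_\alpha\mid\alpha\in\Pi\}$. For $I\subseteq S$: $W_I=\langle I\rangle$ and $\Pi_I=\{\alpha\in\Pi\mid s_\alpha\in I\}$. $W$ acts diagonally on $V^n$. For a subgroup $W'$ of $W$ generated by reflections $s_\alpha$ ($\alpha\in\Phi$), put $\Phi_{W'}=\{\alpha\in\Phi\mid s_\alpha\in W'\}$ and $\mathcal{C}_{W'}=\{v\in V\mid\langle v,\alpha\rangle\ge0\text{ for all }\alpha\in\Phi_{W'}\cap\Phi_+\}$. For $\mathbf{v}\in V^n$ and $0\le m\le n$, $W_{\mathbf{v},m}=\operatorname{Stab}_W(v_1)\cap\dots\cap\operatorname{Stab}_W(v_m)$ (a subgroup generated by reflections; $W_{\mathbf{v},0}=W$),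 and $$\mathcal{C}^{(n)}=\mathcal{C}_W^{(n)}=\{\mathbf{v}\in V^n\mid v_m\in\mathcal{C}_{W_{\mathbf{v},m-1}}\text{ for } m=1,\dots,n\}.$$ For $J\subseteq I\subseteq S$ let $\mathcal{C}_{I,J}=\{v\in V\mid\langle\alpha,v\rangle=0\text{ for }\alpha\in\Pi_J,\ \langle\alpha,v\rangle>0\text{ for }\alpha\in\Pi_{I\setminus J}\}$. $\mathcal{I}^{(n)}=\{(I_0,\dots,I_n)\mid S=I_0\supseteq I_1\supseteq\dots\supseteq I_n\}$, and for $\mathbf{I}=(I_0,\dots,I_n)\in\mathcal{I}^{(n)}$, $\mathcal{X}_{\mathbf{I}}=\mathcal{C}_{I_0,I_1}\times\mathcal{C}_{I_1,I_2}\times\dots\times\mathcal{C}_{I_{n-1},I_n}\subseteq V^n$. The strata of $V^n$ are the sets $w(\mathcal{X}_{\mathbf{I}})$ for $w\in W$, $\mathbf{I}\in\mathcal{I}^{(n)}$. *)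

(* Defs.v *)
From HB Require Import structures.
From mathcomp Require Import all_boot all_order all_algebra.
From mathcomp Require Import finmap.
From mathcomp Require Import all_classical all_reals.
From mathcomp Require Import topology.
From mathcomp Require Import ring.

Set Implicit Arguments.
Unset Strict Implicit.
Unset Printing Implicit Defensive.

Import Order.TTheory GRing.Theory Num.Theory.

Local Open Scope classical_set_scope.
Local Open Scope ring_scope.

(* [vectType] carries no topology: [euclidean dot] is [V] as a metric space. *)
Definition euclidean {R : realType} {V : vectType R}
  (dot : {dot V for (@idfun R)}) : Type := V.

Section EuclideanTopology.
Context {R : realType} {V : vectType R} (dot : {dot V for (@idfun R)}).

Definition edist (u v : V) : R := Num.sqrt (dot (u - v) (u - v)).

Lemma dotC u v : dot u v = dot v u.
Proof. by rewrite hermC/= expr0 mul1r. Qed.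

Lemma dot_ge0 u : 0 <= dot u u.
Proof.
have [->|u0] := eqVneq u 0; first by rewrite linear0r.
exact/ltW/neq0_dnorm_gt0.
Qed.

Lemma dot_CauchySchwarz u v : dot u v ^+ 2 <= dot u u * dot v v.
Proof.
have [->|v0] := eqVneq v 0; first by rewrite !linear0r mulr0 expr0n.
have vv : 0 < dot v v by exact: neq0_dnorm_gt0.
have := dot_ge0 (dot v v *: u - dot u v *: v).
have -> : dot (dot v v *: u - dot u v *: v) (dot v v *: u - dot u v *: v) =
    dot v v * (dot u u * dot v v - dot u v ^+ 2).
  rewrite linearBl !linearBr/= !linearZl_LR !linearZr_LR/= (dotC v u).
  ring.
by rewrite pmulr_rge0// subr_ge0.
Qed.

Lemma edist_triangle v u w : edist u w <= edist u v + edist v w.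
Proof.
rewrite /edist -(subrKA v u (- w)); move: (u - v) (v - w) => {u v w} x y.
have xy : dot x y <= Num.sqrt (dot x x) * Num.sqrt (dot y y).
  rewrite -sqrtrM ?dot_ge0// (le_trans (ler_norm _))// -sqrtr_sqr.
  exact/ler_wsqrtr/dot_CauchySchwarz.
rewrite -[leRHS]ger0_norm ?addr_ge0 ?sqrtr_ge0// -sqrtr_sqr ler_wsqrtr//.
rewrite sqrrD !sqr_sqrtr ?dot_ge0//.
have -> : dot (x + y) (x + y) = dot x x + dot x y *+ 2 + dot y y.
  by rewrite linearDl !linearDr/= (dotC y x) mulr2n !addrA.
by rewrite lerD2r lerD2l lerMn2r xy orbT.
Qed.

Lemma edistxx u : edist u u = 0.
Proof. by rewrite /edist subrr linear0r sqrtr0. Qed.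

Lemma edist_eq0 u v : edist u v = 0 -> u = v.
Proof.
move=> /eqP; rewrite sqrtr_eq0 => uv0; apply/eqP; rewrite -subr_eq0.
by apply: contraLR uv0 => /neq0_dnorm_gt0; rewrite -ltNge; apply.
Qed.

Lemma edistC u v : edist u v = edist v u.
Proof. by rewrite /edist -opprB linearNl linearNr/= opprK. Qed.

HB.instance Definition _ := Choice.copy (euclidean dot) V.
HB.instance Definition _ :=
  isMetric.Build R (euclidean dot) edistxx edist_eq0 edistC edist_triangle.

End EuclideanTopology.

Section LinearGroups.
Context {R : realType} {V : vectType R}.
Implicit Types (G H : set 'End(V)) (f g w : 'End(V)).

(* The first clause makes [f^-1] the genuine inverse on members of [G]. *)
Definition is_linear_group G : Prop :=
  [/\ forall g, G g -> lker g == 0%VS,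
      G \1%VF,
      forall f g, G f -> G g -> G (f \o g)%VF &
      forall g, G g -> G (g^-1)%VF].

Definition generated_group (A : set 'End(V)) : set 'End(V) :=
  smallest is_linear_group A.

Definition conjugate w G : set 'End(V) := [set (w \o g \o w^-1)%VF | g in G].

Definition stabiliser G (v : V) : set 'End(V) := [set g | G g /\ g v = v].

Definition diag_act n w (v : 'I_n -> V) : 'I_n -> V := fun i => w (v i).

Definition diag_stabiliser n G (v : 'I_n -> V) : set 'End(V) :=
  [set g | G g /\ diag_act g v = v].

Definition setwise_stabiliser n G (A : set ('I_n -> V)) : set 'End(V) :=
  [set g | G g /\ diag_act g @` A = A].

End LinearGroups.

Section ReflectionGroups.
Context {R : realType} {V : vectType R} (dot : {dot V for (@idfun R)}).
Implicit Types (Phi Pi : {fset V}) (I J : {fset 'End(V)}).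

Definition coroot (a : V) : V := (2 / dot a a) *: a.

Definition reflection_fun (a v : V) : V := v - dot v (coroot a) *: a.

Lemma reflection_fun_linear a : linear (reflection_fun a).
Proof.
move=> k u v; rewrite /reflection_fun linearPl/= scalerDl scalerBr -scalerA.
by rewrite opprD addrACA.
Qed.

HB.instance Definition _ (a : V) :=
  GRing.isLinear.Build R V V *:%R (reflection_fun a) (reflection_fun_linear a).

Definition reflection (a : V) : 'End(V) := linfun (reflection_fun a).

Definition is_root_system Phi : Prop :=
  [/\ 0 \notin Phi,
      {in Phi &, forall a b, reflection a b \in Phi} &
      forall a (c : R), a \in Phi -> c *: a \in Phi -> c = 1 \/ c = -1].

Definition reflection_group Phi : set 'End(V) :=
  generated_group [set reflection a | a in [set` Phi]].

Definition nonneg_cone Pi : set V :=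
  [set v | exists2 c : V -> R,
     forall a, 0 <= c a & v = \sum_(a <- Pi) c a *: a].

Definition positive_roots Phi Pi : set V := [set` Phi] `&` nonneg_cone Pi.

Definition is_simple_system Phi Pi : Prop :=
  let P := positive_roots Phi Pi in
  let N := [set - a | a in P] in
  [/\ (Pi `<=` Phi)%fset, free Pi, [set` Phi] = P `|` N & P `&` N = set0].

Definition simple_reflections Pi : {fset 'End(V)} :=
  [fset reflection a | a in Pi]%fset.

Definition parabolic I : set 'End(V) := generated_group [set` I].

Definition simple_roots_of Pi I : {fset V} :=
  [fset a in Pi | reflection a \in I]%fset.

Definition roots_of Phi (G : set 'End(V)) : set V :=
  [set a | a \in Phi /\ G (reflection a)].

Definition chamber Phi Pi (G : set 'End(V)) : set V :=
  [set v | forall a, (roots_of Phi G `&` positive_roots Phi Pi) a ->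
                     0 <= dot v a].

(* W_{v,m}: the coordinates v_1, ..., v_m are numbered 0, ..., m - 1 here. *)
Definition stab_upto Phi n (v : 'I_n -> V) (m : nat) : set 'End(V) :=
  [set w | reflection_group Phi w /\
           forall i : 'I_n, (i < m)%N ->
             stabiliser (reflection_group Phi) (v i) w].

Definition iterated_chamber Phi Pi n : set ('I_n -> V) :=
  [set v | forall m : 'I_n, chamber Phi Pi (stab_upto Phi v m) (v m)].

Definition face Pi I J : set V :=
  [set v | (forall a, a \in simple_roots_of Pi J -> dot a v = 0) /\
           (forall a, a \in simple_roots_of Pi (I `\` J)%fset -> 0 < dot a v)].

Definition is_chain Pi n (I : 'I_n.+1 -> {fset 'End(V)}) : Prop :=
  I ord0 = simple_reflections Pi /\
  forall i : 'I_n, (I (lift ord0 i) `<=` I (widen_ord (leqnSn n) i))%fset.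

Definition chain_stratum Pi n (I : 'I_n.+1 -> {fset 'End(V)}) :
    set ('I_n -> V) :=
  [set v | forall i : 'I_n,
     face Pi (I (widen_ord (leqnSn n) i)) (I (lift ord0 i)) (v i)].

Definition strata Phi Pi n : set (set ('I_n -> V)) :=
  [set A | exists w (I : 'I_n.+1 -> {fset 'End(V)}),
     [/\ reflection_group Phi w, is_chain Pi I &
         A = diag_act w @` chain_stratum Pi I]].

Definition disjoint_union_of_strata Phi Pi n (A : set ('I_n -> V)) : Prop :=
  let D := [set B | strata Phi Pi B /\ B `<=` A] in
  A = \bigcup_(B in D) B /\ trivIset D id.

(* Closure for the product topology on V^n. *)
Definition power_closure n (A : set ('I_n -> V)) : set ('I_n -> V) :=
  closure (A : set {ptws 'I_n -> euclidean dot}).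

End ReflectionGroups.

(* Main.v *)
Require Import Defs.
From mathcomp Require Import all_boot all_order all_algebra.
From mathcomp Require Import finmap.
From mathcomp Require Import all_classical all_reals.
From mathcomp Require Import topology.
From mathcomp Require Import ring.

Set Implicit Arguments.
Unset Strict Implicit.
Unset Printing Implicit Defensive.

Import Order.TTheory GRing.Theory Num.Theory.

Local Open Scope classical_set_scope.
Local Open Scope ring_scope.

(** Everything rests on the classical theory of a dominant (closed) Weyl chamber
for a standard parabolic subgroup [W_J], with [J] a set of simple roots:

- every vector is [W_J]-conjugate to a [J]-dominant one ([exists_dominant]);
- if [v] and [g v] are both [J]-dominant with [g] in [W_J], then [g] already lies
  in the parabolic subgroup of the simple roots of [J] orthogonal to [v]
  ([dominant_conjugate]); in particular [g v = v].

A stratum [X_I] consists of tuples whose entry [v_i] is dominant for [I_i] and has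
[I_{i+1}] as its exact set of orthogonal simple roots inside [I_i].  Applying the two
facts one coordinate at a time, with [J] running through the successive levels of the
chain, shows that every tuple is conjugate into some [X_I] ([stratum_cover]) and that
an element [u] of [W] carrying a point of [X_J] to a point of [X_I] forces [I = J] and
[u] in [W_{I_n}] ([stratum_conjugate]).  Since [W_{I_n}] fixes [X_I] pointwise and
[X_I] is nonempty, (b), (c), (d) and disjointness in (e) follow formally.

The chamber [C^(n)] is governed by all positive roots orthogonal to the previous
coordinates, and not only by simple ones.  The link is [positive_support]: on [X_I], a
positive root orthogonal to [v_0, ..., v_{k-1}] is a combination of the simple roots of
level [k].  This gives (a), and hence that [C^(n)] is the union of the sets [X_I].

For (f), the closure of [w X_I] is obtained by weakening the strict inequalities of
[X_I] ([closure_stratum]).  It is a union of strata because the condition imposed at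
coordinate [i] concerns a root that is orthogonal to all previous coordinates; by
[positive_support], the sign of such a root at coordinate [i] is the same at all points
of a stratum ([stratum_root_sign], [closed_stratum_saturated]). *)

(** * Reflections and the groups they generate *)

Section Reflections.
Context {R : realType} {V : vectType R} (dot : {dot V for (@idfun R)}).
Implicit Types (a b u v w : V) (s t : seq V) (J : set V) (g : 'End(V)).

Lemma dotBr u v w : dot u (v - w) = dot u v - dot u w.
Proof. by rewrite linearBr. Qed.

Lemma dotBl u v w : dot (u - v) w = dot u w - dot v w.
Proof. by rewrite linearBl. Qed.

Lemma dotNr u v : dot u (- v) = - dot u v.
Proof. by rewrite linearNr. Qed.

Lemma dotZr (k : R) u v : dot u (k *: v) = k * dot u v.
Proof. by rewrite linearZr_LR. Qed.

Lemma dotZl (k : R) u v : dot (k *: u) v = k * dot u v.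
Proof. by rewrite linearZl_LR. Qed.

Lemma reflectionE a v :
  reflection dot a v = v - (2 / dot a a * dot v a) *: a.
Proof. by rewrite lfunE /= /reflection_fun /coroot dotZr. Qed.

Lemma dot_reflection a u v :
  dot (reflection dot a u) (reflection dot a v) = dot u v.
Proof.
rewrite !reflectionE; have [->|a0] := eqVneq a 0.
  by rewrite !scaler0 !subr0.
rewrite !dotBl !dotBr !dotZl !dotZr (dotC dot a v).
have : dot a a != 0 by rewrite gt_eqF ?neq0_dnorm_gt0.
move: (dot a a) (dot u a) (dot v a) (dot u v) => p x y z p0.
by field.
Qed.

Lemma reflectionK a : involutive (reflection dot a).
Proof.
move=> v; rewrite !reflectionE; have [->|a0] := eqVneq a 0.
  by rewrite !scaler0 !subr0.
have pa : dot a a != 0 by rewrite gt_eqF ?neq0_dnorm_gt0.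
rewrite dotBl dotZl -addrA -opprD -scalerDl.
rewrite [X in X *: a](_ : _ = 0) ?scale0r ?subr0//.
by field.
Qed.

Lemma reflection_self a : reflection dot a a = - a.
Proof.
rewrite reflectionE; have [->|a0] := eqVneq a 0.
  by rewrite scaler0 subr0 oppr0.
have pa : dot a a != 0 by rewrite gt_eqF ?neq0_dnorm_gt0.
rewrite divfK// -[X in X - _]scale1r -scalerBl.
by rewrite (_ : 1 - 2 = -1 :> R) ?scaleN1r//; ring.
Qed.

Lemma reflection_id a v : dot v a = 0 -> reflection dot a v = v.
Proof. by move=> va; rewrite reflectionE va mulr0 scale0r subr0. Qed.

Lemma reflection_fixP a v : a != 0 -> reflection dot a v = v -> dot v a = 0.
Proof.
move=> a0; have pa : dot a a != 0 by rewrite gt_eqF ?neq0_dnorm_gt0.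
rewrite reflectionE -[RHS]subr0 => /addrI/oppr_inj/eqP.
by rewrite scaler_eq0 (negbTE a0) orbF !mulf_eq0 invr_eq0 (negbTE pa) pnatr_eq0/=
  => /eqP.
Qed.

Definition word s : 'End(V) :=
  foldr (fun a g => (reflection dot a \o g)%VF) \1%VF s.

(** The group generated by the reflections in [J], presented by words so that one can
argue by induction on the length of an expression. *)
Definition words J : set 'End(V) :=
  [set g | exists2 s, (forall a, a \in s -> J a) & g = word s].

Lemma word_cons a s v : word (a :: s) v = reflection dot a (word s v).
Proof. by rewrite /= comp_lfunE. Qed.

Lemma word_nil v : word [::] v = v.
Proof. by rewrite /= id_lfunE. Qed.

Lemma word_cat s t v : word (s ++ t) v = word s (word t v).
Proof. by elim: s => [|a s IH]; rewrite ?word_nil // cat_cons !word_cons IH. Qed.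

Lemma word_rcons s a v : word (rcons s a) v = word s (reflection dot a v).
Proof. by rewrite -cats1 word_cat word_cons word_nil. Qed.

Lemma wordK s : cancel (word s) (word (rev s)).
Proof.
elim: s => [|a s IH] v; first by rewrite !word_nil.
by rewrite rev_cons word_rcons word_cons reflectionK.
Qed.

Lemma dot_word s u v : dot (word s u) (word s v) = dot u v.
Proof.
by elim: s => [|a s IH]; rewrite ?word_nil// !word_cons dot_reflection.
Qed.

Lemma word_lker0 s : lker (word s) == 0%VS.
Proof. by apply/lker0P/can_inj/wordK. Qed.

Lemma word_inv s : ((word s)^-1)%VF = word (rev s).
Proof.
apply/lfunP => v; apply: (can_inj (wordK s)).
by rewrite lker0_lfunVK ?word_lker0// -{1}(revK s) wordK.
Qed.

Lemma words_linear_group J : is_linear_group (words J).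
Proof.
split.
- by move=> _ [s _ ->]; exact: word_lker0.
- by exists [::].
- move=> _ _ [s sJ ->] [t tJ ->]; exists (s ++ t).
    by move=> a; rewrite mem_cat => /orP[/sJ|/tJ].
  by apply/lfunP => v; rewrite comp_lfunE word_cat.
- move=> _ [s sJ ->]; exists (rev s); last exact: word_inv.
  by move=> a; rewrite mem_rev; exact: sJ.
Qed.

(** Reflections are involutions, so reversing a word inverts its product and the
products of words already form a group. *)
Lemma generated_group_words J :
  generated_group [set reflection dot a | a in J] = words J.
Proof.
apply/seteqP; split.
  apply: smallest_sub; first exact: words_linear_group.
  move=> _ [a Ja <-]; exists [:: a] => [b|]; first by rewrite inE => /eqP->.
  by apply/lfunP => v; rewrite word_cons word_nil.
move=> _ [s sJ ->] G [[_ G1 GM _] JG].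
elim: s sJ => [|a s IH] sJ; first exact: G1.
apply: GM; first by apply: JG; exists a => //; apply: sJ; rewrite mem_head.
by apply: IH => b bs; apply: sJ; rewrite inE bs orbT.
Qed.

Lemma words_id J : words J \1%VF.
Proof. by have [_ + _ _] := words_linear_group J. Qed.

Lemma words_reflection J a : J a -> words J (reflection dot a).
Proof.
move=> Ja; exists [:: a] => [b|]; first by rewrite inE => /eqP->.
by apply/lfunP => v; rewrite word_cons word_nil.
Qed.

Lemma words_mul J g h : words J g -> words J h -> words J (g \o h)%VF.
Proof. by have [_ _ + _] := words_linear_group J; apply. Qed.

Lemma words_inv J g : words J g -> words J g^-1%VF.
Proof. by have [_ _ _ +] := words_linear_group J; apply. Qed.

Lemma wordsK J g : words J g -> cancel g g^-1%VF.
Proof. by move=> [s _ ->]; apply: lker0_lfunK; exact: word_lker0. Qed.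

Lemma wordsVK J g : words J g -> cancel g^-1%VF g.
Proof. by move=> [s _ ->]; apply: lker0_lfunVK; exact: word_lker0. Qed.

Lemma dot_words J g u v : words J g -> dot (g u) (g v) = dot u v.
Proof. by move=> [s _ ->]; exact: dot_word. Qed.

Lemma words_fix J g v :
  words J g -> (forall a, J a -> dot v a = 0) -> g v = v.
Proof.
move=> [s sJ ->] vJ; elim: s sJ => [|a s IH] sJ; first by rewrite word_nil.
rewrite word_cons IH => [|b bs]; last by apply: sJ; rewrite inE bs orbT.
by rewrite reflection_id// vJ//; apply: sJ; rewrite mem_head.
Qed.

Lemma words_sub J K : J `<=` K -> words J `<=` words K.
Proof. by move=> JK _ [s sJ ->]; exists s => // a /sJ/JK. Qed.

(** This is the identity [w s_a w^-1 = s_(w a)], which only uses that [w] is an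
isometry. *)
Lemma word_reflection s a v :
  word s (reflection dot a v) = reflection dot (word s a) (word s v).
Proof. by rewrite !reflectionE !dot_word linearB linearZ. Qed.

End Reflections.

(** * The basis dual to a simple system *)

Section DualBasis.
Context {R : realType} {V : vectType R} (dot : {dot V for (@idfun R)}).
Implicit Types (Pi : {fset V}) (a b : V).

(** The coefficient of a simple root [b] in a linear combination of simple roots is the
inner product with [coweight Pi b], so positivity of roots becomes a sign condition.
Choosing the dual vectors by [xget] makes them total in [Pi]. *)
Definition coweight Pi : V -> V :=
  xget (fun=> 0) [set w | {in Pi &, forall a b, dot (w b) a = (a == b)%:R}].

(** The Gram matrix of a free family is invertible: a row vector in its kernel gives a
combination of the family that is orthogonal to itself, hence zero.  The dual vectors
are the combinations whose coefficients are the rows of the inverse. *)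
Lemma coweightE Pi : free Pi ->
  {in Pi &, forall a b, dot (coweight Pi b) a = (a == b)%:R}.
Proof.
move=> fPi; rewrite /coweight; case: xgetP => // /forallNP nodual.
pose X := in_tuple (enum_fset Pi); set n := size _ in X.
pose G := \matrix_(i < n, j < n) dot X`_i X`_j.
have Gu : G \in unitmx.
  rewrite -row_free_unit -kermx_eq0; apply/eqP/row_matrixP => i.
  rewrite row0; set x := row i _.
  have xG : x *m G = 0 by rewrite -row_mul mulmx_ker row0.
  have x0 : \sum_j x 0 j *: X`_j = 0.
    apply/eqP/contraT => /(neq0_dnorm_gt0 (s := dot)).
    rewrite [ltRHS]linear_sumr [ltRHS]big1 ?ltxx// => j _.
    rewrite /= dotZr linear_sumlz/=.
    move/rowP/(_ j): xG; rewrite mxE [RHS]mxE => xGj.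
    rewrite -[RHS](mulr0 (x 0 j)) -[in RHS]xGj; congr (_ * _).
    by apply: eq_bigr => k _; rewrite dotZl [G _ _]mxE.
  have fX : free X by [].
  by apply/rowP => j; rewrite (elimT freeP fX _ x0 j) mxE.
pose r b : 'rV[R]_n := (\row_i (X`_i == b)%:R) *m invmx G.
case: nodual; exists (fun b => \sum_j r b 0 j *: X`_j) => a b aPi bPi /=.
have [k ->] : exists k : 'I_n, a = X`_k.
  by have /(nthP 0)[k kn <-] := aPi; exists (Ordinal kn).
rewrite linear_sumlz /=.
transitivity ((r b *m G) 0 k); last by rewrite mulmxKV// mxE.
by rewrite mxE; apply: eq_bigr => j _; rewrite dotZl [G _ _]mxE.
Qed.

End DualBasis.

(** * Simple systems, exchange and dominance *)

Section SimpleSystem.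
Context {R : realType} {V : vectType R} (dot : {dot V for (@idfun R)}).
Variables (Phi Pi : {fset V}).
Hypothesis Phi_root : is_root_system dot Phi.
Hypothesis Pi_simple : is_simple_system Phi Pi.
Implicit Types (a b u v w : V) (s t : seq V) (J : set V) (g : 'End(V)).

Local Notation s_ := (reflection dot).
Local Notation P := (positive_roots Phi Pi).
Local Notation om := (coweight dot Pi).

Lemma simple_root a : a \in Pi -> a \in Phi.
Proof. by case: Pi_simple => /fsubsetP + _ _ _; apply. Qed.

Lemma root_neq0 a : a \in Phi -> a != 0.
Proof.
by case: Phi_root => + _ _ aPhi; apply: contraNneq => <-.
Qed.

Lemma root_reflection a b : a \in Phi -> b \in Phi -> s_ a b \in Phi.
Proof. by case: Phi_root => _ + _; apply. Qed.

Lemma root_opp a : a \in Phi -> - a \in Phi.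
Proof. by move=> aPhi; rewrite -(reflection_self dot) root_reflection. Qed.

Lemma root_words g a : words dot [set` Phi] g -> a \in Phi -> g a \in Phi.
Proof.
move=> [s sPhi ->] aPhi; elim: s sPhi => [|b s IH] sPhi.
  by rewrite word_nil.
rewrite word_cons root_reflection//; first by apply: sPhi; rewrite mem_head.
by apply: IH => c cs; apply: sPhi; rewrite inE cs orbT.
Qed.

Lemma dot_coweight : {in Pi &, forall a b, dot (om b) a = (a == b)%:R}.
Proof. by apply: coweightE; case: Pi_simple. Qed.

Lemma dot_coweight_sum (c : V -> R) b : b \in Pi ->
  dot (om b) (\sum_(a <- Pi) c a *: a) = c b.
Proof.
move=> bPi; rewrite linear_sumr (big_fsetD1 b)//= dotZr dot_coweight// eqxx.
rewrite mulr1 big_seq big1 ?addr0// => a /fsetD1P[ab aPi].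
by rewrite dotZr dot_coweight// (negbTE ab) mulr0.
Qed.

Lemma positive_expansion b : P b ->
  b = \sum_(a <- Pi) dot (om a) b *: a.
Proof.
move=> [_ [c c0 bE]]; rewrite {1}bE; apply: eq_big_seq => a aPi.
by rewrite [in RHS]bE dot_coweight_sum.
Qed.

Lemma root_pos_or_neg b : b \in Phi -> P b \/ P (- b).
Proof.
move=> bPhi; case: Pi_simple => _ _ PhiE _.
have : [set` Phi] b by [].
rewrite PhiE => -[|[a Pa <-]]; first by left.
by rewrite opprK; right.
Qed.

Lemma root_expansion b : b \in Phi -> b = \sum_(a <- Pi) dot (om a) b *: a.
Proof.
case/root_pos_or_neg => [|/positive_expansion bE]; first exact: positive_expansion.
rewrite -[LHS]opprK bE -sumrN; apply: eq_bigr => a _.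
by rewrite dotNr scaleNr opprK.
Qed.

Lemma dot_root_expansion v b : b \in Phi ->
  dot v b = \sum_(a <- Pi) dot (om a) b * dot v a.
Proof.
move=> /root_expansion {1}->; rewrite linear_sumr.
by apply: eq_bigr => a _; rewrite /= dotZr.
Qed.

Lemma positive_coef_ge0 a b : a \in Pi -> P b -> 0 <= dot (om a) b.
Proof. by move=> aPi [_ [c c0 ->]]; rewrite dot_coweight_sum. Qed.

Lemma positiveP b : b \in Phi ->
  P b <-> (forall a, a \in Pi -> 0 <= dot (om a) b).
Proof.
move=> bPhi; split=> [Pb a aPi|b0]; first exact: positive_coef_ge0.
split=> //; exists (fun a => Num.max 0 (dot (om a) b)) => [a|].
  by rewrite le_max lexx.
rewrite {1}(root_expansion bPhi); apply: eq_big_seq => a aPi.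
by rewrite max_r ?b0.
Qed.

Lemma positive_coef_gt0 b : P b -> exists2 a, a \in Pi & 0 < dot (om a) b.
Proof.
move=> Pb; apply/exists2P; rewrite not_existsP => b0.
have [bPhi _] := Pb; have /eqP[] := root_neq0 bPhi.
rewrite (root_expansion bPhi) big_seq big1// => a aPi.
have := b0 a; rewrite lt_neqAle positive_coef_ge0// andbT.
by have [<-|_ []] := eqVneq 0 (dot (om a) b); rewrite ?scale0r.
Qed.

Lemma positive_not_neg b : P b -> ~ P (- b).
Proof.
move=> /positive_coef_gt0[a aPi a0] /(positive_coef_ge0 aPi).
by rewrite dotNr oppr_ge0 leNgt a0.
Qed.

Lemma simple_positive a : a \in Pi -> P a.
Proof.
move=> aPi; apply/positiveP; first exact: simple_root.
by move=> b bPi; rewrite dot_coweight.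
Qed.

Lemma coweight_reflection a b v : a \in Pi -> b \in Pi -> b != a ->
  dot (om b) (s_ a v) = dot (om b) v.
Proof.
move=> aPi bPi ba; rewrite reflectionE dotBr dotZr (dot_coweight aPi bPi).
by rewrite (eq_sym a) (negbTE ba) mulr0 subr0.
Qed.

(** The reflection [s_a] changes only the coefficient at [a].  As the system is
reduced, [b] has a positive coefficient at another simple root, which survives in
[s_a b] and prevents that root from being negative. *)
Lemma positive_reflection a b : a \in Pi -> P b -> b != a -> P (s_ a b).
Proof.
move=> aPi Pb ba; have [bPhi _] := Pb.
have [c [cPi ca c0]] : exists c, [/\ c \in Pi, c != a & 0 < dot (om c) b].
  apply: contrapT => nc; case/eqP: ba.
  have bE : b = dot (om a) b *: a.
    rewrite {1}(root_expansion bPhi) (big_fsetD1 a)//= big_seq big1 ?addr0//.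
    move=> c /fsetD1P[ca cPi]; have := positive_coef_ge0 cPi Pb.
    rewrite le_eqVlt => /predU1P[<-|c0]; first by rewrite scale0r.
    by case: nc; exists c.
  have [_ _ /(_ a (dot (om a) b) (simple_root aPi))] := Phi_root.
  rewrite -bE => /(_ bPhi)[k1|kN1]; first by rewrite bE k1 scale1r.
  by have := positive_coef_ge0 aPi Pb; rewrite kN1 ler0N1.
case: (root_pos_or_neg (root_reflection (simple_root aPi) bPhi)) => //.
move=> /(positive_coef_ge0 cPi).
by rewrite dotNr coweight_reflection// oppr_ge0 leNgt c0.
Qed.

Lemma words_simple_root g : words dot [set` Pi] g -> words dot [set` Phi] g.
Proof. by apply: words_sub => a /simple_root. Qed.

(** Reading the word [s] from the right, consider the letter [b] that first makes the
image of [a] negative.  By [positive_reflection] that image was [b] itself, so [s_b]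
can be traded for [s_a] on the right, and the two copies of [s_a] cancel. *)
Lemma exchange s a : (forall b, b \in s -> b \in Pi) -> a \in Pi ->
  ~ P (word dot s a) ->
  exists t, [/\ (size t < size s)%N, {subset t <= s} &
                word dot t = (word dot s \o s_ a)%VF].
Proof.
elim: s => [|b s IH] sPi aPi nP.
  by case: nP; rewrite word_nil; exact: simple_positive.
have bPi : b \in Pi by apply: sPi; rewrite mem_head.
have {}sPi c : c \in s -> c \in Pi by move=> cs; apply: sPi; rewrite inE cs orbT.
have [Psa|nPsa] := pselect (P (word dot s a)); last first.
  have [t [ts tS tE]] := IH sPi aPi nPsa; exists (b :: t); split=> //.
    by move=> c; rewrite !inE => /orP[->//|/tS ->]; rewrite orbT.
  by apply/lfunP => v; rewrite comp_lfunE !word_cons tE comp_lfunE.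
have sab : word dot s a = b.
  apply/eqP/contraT => sab; case: nP.
  by rewrite word_cons; exact: positive_reflection.
exists s; split=> //; first by move=> c cs; rewrite inE cs orbT.
apply/lfunP => v; rewrite comp_lfunE word_cons word_reflection sab.
by rewrite reflectionK.
Qed.

(** The reflections in [J] fix the coweight of [b], so the image of a root under [W_J]
changes only in its coefficients along [J]. *)
Lemma coweight_words J b g v : J `<=` [set` Pi] -> b \in Pi -> ~ J b ->
  words dot J g -> dot (om b) (g v) = dot (om b) v.
Proof.
move=> JPi bPi nJb Jg; rewrite -[RHS](dot_words _ _ Jg) (words_fix (v := om b) Jg)//.
move=> a Ja; rewrite dot_coweight//; last exact: JPi.
by have [ab|//] := eqVneq a b; move: nJb; rewrite -ab.
Qed.

Definition dominant J v := forall a, J a -> 0 <= dot v a.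

Lemma dominant_positive v b : P b ->
  (forall a, a \in Pi -> dot (om a) b != 0 -> 0 <= dot v a) -> 0 <= dot v b.
Proof.
move=> Pb vb; have [bPhi _] := Pb; rewrite dot_root_expansion// big_seq.
apply: sumr_ge0 => a aPi; have [->|a0] := eqVneq (dot (om a) b) 0.
  by rewrite mul0r.
by rewrite mulr_ge0 ?vb// positive_coef_ge0.
Qed.

(** Induction on the length of a word [s a] for [g].  If [s] sends [a] to a negative
root, the exchange lemma gives a shorter word.  Otherwise [g a = - s a] is a negative
root supported on [J]; pairing it with [g v] gives a nonpositive number, while it
equals the nonnegative [dot v a].  Hence [v] is orthogonal to [a], and the last letter
can be dropped without changing [g v]. *)
Lemma dominant_conjugate J v g : J `<=` [set` Pi] -> words dot J g ->
  dominant J v -> dominant J (g v) ->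
  words dot [set a | J a /\ dot v a = 0] g.
Proof.
move=> JPi [s sJ ->]; have [m] := ubnP (size s).
elim: m => // m IH in s sJ *; case/lastP: s sJ => [|s a] sJ.
  by move=> _ _ _; exists [::].
rewrite size_rcons ltnS => sm vJ gvJ.
have Ja : J a by apply: sJ; rewrite mem_rcons mem_head.
have {}sJ b : b \in s -> J b.
  by move=> bs; apply: sJ; rewrite mem_rcons inE bs orbT.
have saE : word dot (rcons s a) = (word dot s \o s_ a)%VF.
  by apply/lfunP => w; rewrite comp_lfunE word_rcons.
have [Psa|nPsa] := pselect (P (word dot s a)); last first.
  have [t [ts tS tE]] := exchange (fun b bs => JPi b (sJ b bs)) (JPi a Ja) nPsa.
  rewrite saE -tE; apply: IH => //; last by rewrite tE -saE.
    by move=> b /tS/sJ.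
  exact: ltn_trans ts sm.
have va : dot v a = 0.
  apply/eqP; rewrite eq_le vJ// andbT -oppr_ge0.
  have -> : - dot v a = dot (word dot (rcons s a) v) (word dot s a).
    rewrite -(dot_word _ (rcons s a)) -dotNr -linearN/= word_rcons.
    rewrite -(reflection_self dot) word_rcons.
    by rewrite reflectionK -word_rcons.
  apply: dominant_positive => // b bPi b0; apply: gvJ.
  apply: contrapT => nJb; move: b0.
  rewrite (coweight_words _ JPi bPi nJb); last by exists s.
  rewrite dot_coweight//; last exact: JPi.
  by have [ab|] := eqVneq a b; [move: nJb; rewrite -ab|rewrite eqxx].
have sav : word dot (rcons s a) v = word dot s v.
  by rewrite word_rcons reflection_id.
rewrite saE; apply: words_mul; first by apply: IH => //; rewrite -sav.
exact: words_reflection.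
Qed.

(** Reflecting [v] in a simple root [a] of [J] with [dot v a < 0] lowers the number of
positive roots that are negative on [v], since [s_a] permutes the positive roots other
than [a]. *)
Lemma exists_dominant J v : J `<=` [set` Pi] ->
  exists2 g, words dot J g & dominant J (g v).
Proof.
move=> JPi; pose N w := [fset b in Phi | `[< P b /\ dot w b < 0 >]]%fset.
have [m] := ubnP #|` N v|; elim: m => // m IH in v *; rewrite ltnS => Nm.
have [vJ|] := pselect (dominant J v).
  exists \1%VF; last by rewrite id_lfunE.
  exact: words_id.
move=> /existsNP[a /not_implyP[Ja /negP]]; rewrite -ltNge => va.
have aPi : a \in Pi by exact: JPi.
have [|g Jg gJ] := IH (s_ a v).
  apply: leq_trans Nm.
  have <- : #|` [fset s_ a b | b in N (s_ a v)]%fset| = #|` N (s_ a v)|.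
    by rewrite card_imfset//; exact: (can_inj (@reflectionK _ _ dot a)).
  apply: fproper_ltn_card; rewrite fproperE; apply/andP; split.
    apply/fsubsetP => _ /imfsetP[b /= + ->]; rewrite !inE => /andP[bPhi /asboolP[Pb vb]].
    have ba : b != a.
      apply: contraTneq vb => ->; rewrite -leNgt.
      rewrite -(dot_reflection dot a) reflectionK reflection_self dotNr.
      by rewrite oppr_ge0 ltW.
    rewrite (root_reflection (simple_root aPi) bPhi)/=; apply/asboolP; split.
      exact: positive_reflection.
    by rewrite -(dot_reflection dot a) reflectionK.
  apply/negP => /fsubsetP/(_ a); rewrite !inE simple_root//=.
  have -> : `[< P a /\ dot v a < 0 >].
    by apply/asboolP; split=> //; exact: simple_positive.
  move=> /(_ isT)/imfsetP[b /=]; rewrite !inE => /andP[bPhi /asboolP[Pb _]] ab.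
  apply: (positive_not_neg Pb).
  rewrite -(reflectionK dot a b) -ab reflection_self opprK.
  exact: simple_positive.
exists (g \o s_ a)%VF; last by rewrite comp_lfunE.
apply: words_mul => //; exact: words_reflection.
Qed.

(** Induction on the number of roots of smaller height, the height being the sum of
the coefficients.  As [dot b b > 0], some simple root [a] satisfies [dot b a > 0], and
[s_a b] is a positive root of smaller height unless [b = a]. *)
Lemma root_conjugate_simple b : P b ->
  exists g a, [/\ words dot [set` Pi] g, a \in Pi & b = g a].
Proof.
pose h c := \sum_(a <- Pi) dot (om a) c.
pose N c := [fset d in Phi | h d < h c]%fset.
have [m] := ubnP #|` N b|; elim: m => // m IH in b *; rewrite ltnS => Nm Pb.
have [bPi|bPi] := boolP (b \in Pi).
  exists \1%VF, b; split=> //; last by rewrite id_lfunE.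
  exact: words_id.
have [bPhi _] := Pb.
have [a aPi ab] : exists2 a, a \in Pi & 0 < dot b a.
  apply: contrapT => nab; have := neq0_dnorm_gt0 (s := dot) _ (root_neq0 bPhi).
  rewrite (dot_root_expansion b bPhi) ltNge => /negP; apply.
  rewrite -oppr_ge0 -sumrN big_seq sumr_ge0// => a aPi.
  rewrite -mulrN mulr_ge0 ?positive_coef_ge0// oppr_ge0 leNgt.
  by apply/negP => ab; apply: nab; exists a.
have Psb : P (s_ a b).
  by apply: positive_reflection => //; apply: contraNneq bPi => ->.
have hsb : h (s_ a b) < h b.
  rewrite /h (big_fsetD1 a)//= [ltRHS](big_fsetD1 a)//=.
  rewrite [X in _ + X](_ : _ = \sum_(c <- (Pi `\ a)%fset) dot (om c) b).
    rewrite ltrD2r reflectionE dotBr dotZr (dot_coweight aPi aPi) eqxx mulr1.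
    rewrite gtrBl mulr_gt0// divr_gt0//.
    by apply: neq0_dnorm_gt0; apply/root_neq0/simple_root.
  apply: eq_big_seq => c /fsetD1P[ca cPi].
  by rewrite coweight_reflection.
have [|g [c [Pig cPi bE]]] := IH (s_ a b) _ Psb.
  apply: leq_trans Nm; apply: fproper_ltn_card; rewrite fproperE; apply/andP; split.
    apply/fsubsetP => c; rewrite !inE => /andP[-> ch] /=; exact: lt_trans hsb.
  apply/negP => /fsubsetP/(_ (s_ a b)); rewrite !inE ltxx hsb andbF andbT.
  by move=> /(_ (root_reflection (simple_root aPi) bPhi)).
exists (s_ a \o g)%VF, c; split=> //; last first.
  by rewrite comp_lfunE -bE reflectionK.
apply: words_mul => //; exact: words_reflection.
Qed.

(** Each root is [g a] with [a] simple and [g] a product of simple reflections, so its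
reflection is [g s_a g^-1]. *)
Lemma reflection_groupE : reflection_group dot Phi = words dot [set` Pi].
Proof.
rewrite /reflection_group generated_group_words; apply/seteqP; split; last first.
  by apply: words_sub => a /simple_root.
rewrite -generated_group_words; apply: smallest_sub.
  exact: words_linear_group.
suff posW b : P b -> words dot [set` Pi] (s_ b).
  move=> _ [b /= /root_pos_or_neg[|/posW] + <-]; first exact: posW.
  congr (words _ _ _); apply/lfunP => v; rewrite !reflectionE.
  by rewrite linearNl/= !dotNr opprK mulrN scaleNr scalerN opprK.
move=> /root_conjugate_simple[g [a [Pig aPi ->]]].
have -> : s_ (g a) = (g \o (s_ a \o g^-1))%VF.
  apply/lfunP => v; rewrite !comp_lfunE.
  have [s _ gE] := Pig; rewrite {2}gE word_reflection -gE.
  by rewrite (wordsVK Pig).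
apply: words_mul => //; apply: words_mul; last exact: words_inv.
exact: words_reflection.
Qed.

End SimpleSystem.

(** * Strata and their conjugates *)

Section Strata.
Context {R : realType} {V : vectType R} (dot : {dot V for (@idfun R)}).
Variables (Phi Pi : {fset V}).
Hypothesis Phi_root : is_root_system dot Phi.
Hypothesis Pi_simple : is_simple_system Phi Pi.
Variable n : nat.
Implicit Types (a b : V) (g w : 'End(V)).
Implicit Types (I J : 'I_n.+1 -> {fset 'End(V)}) (v x y : 'I_n -> V).

Local Notation s_ := (reflection dot).
Local Notation P := (positive_roots Phi Pi).
Local Notation W := (reflection_group dot Phi).
Local Notation X := (chain_stratum dot Pi).

(** The simple roots of [I_k].  Indexing by a natural number, through [inord], lets the
arguments below run by induction on [k]; only [k <= n] is meaningful. *)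
Definition level I (k : nat) : set V := [set a | a \in Pi /\ s_ a \in I (inord k)].

Lemma level_simple I k : level I k `<=` [set` Pi].
Proof. by move=> a []. Qed.

Lemma inord_lift0 (i : 'I_n) : lift ord0 i = inord i.+1.
Proof. by apply: val_inj; rewrite /= inordK// ltnS. Qed.

Lemma inord_widen (i : 'I_n) : widen_ord (leqnSn n) i = inord i.
Proof. by apply: val_inj; rewrite /= inordK// ltnW// ltnS. Qed.

Lemma chain_stratumP I v : X I v <-> forall i : 'I_n, 
  (forall a, level I i.+1 a -> dot (v i) a = 0) /\
  (forall a, level I i a -> ~ level I i.+1 a -> 0 < dot (v i) a).
Proof.
rewrite /level; split=> Xv i; have := Xv i.
  rewrite /face /= inord_lift0 inord_widen => -[v0 v_gt0]; split=> a.
    by move=> [aPi aI]; rewrite dotC v0// !inE aPi.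
  move=> [aPi aI] naI; rewrite dotC v_gt0// !inE aPi aI andbT/=.
  by apply/negP => aI'; apply: naI.
move=> [v0 v_gt0]; rewrite /face /= inord_lift0 inord_widen; split=> a.
  by rewrite !inE/= => /andP[aPi aI]; rewrite dotC v0.
rewrite !inE/= => /and3P[aPi naI aI]; rewrite dotC v_gt0//.
by move=> [_ aI']; rewrite aI' in naI.
Qed.

Lemma level0 I : is_chain dot Pi I -> level I 0 = [set` Pi].
Proof.
move=> [I0 _]; apply/seteqP; split=> [a []//|a aPi]; split=> //.
rewrite (_ : inord 0 = ord0) ?I0; last by apply: val_inj; rewrite /= inordK.
by apply/imfsetP; exists a.
Qed.

Lemma chain_succ_sub I k : is_chain dot Pi I -> (k < n)%N ->
  (I (inord k.+1) `<=` I (inord k))%fset.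
Proof.
move=> [_ IS] kn; have := IS (Ordinal kn).
by rewrite inord_lift0 inord_widen.
Qed.

Lemma chain_decreasing I j k : is_chain dot Pi I -> (j <= k <= n)%N ->
  (I (inord k) `<=` I (inord j))%fset.
Proof.
move=> cI /andP[/subnKC <-]; elim: (k - j)%N => [|d IH]; first by rewrite addn0.
rewrite addnS => jdn; apply: fsubset_trans (IH (ltnW jdn)).
exact: chain_succ_sub.
Qed.

Lemma level_sub I j k : is_chain dot Pi I -> (j <= k <= n)%N ->
  level I k `<=` level I j.
Proof.
by move=> cI jk a [aPi aI]; split=> //; apply: fsubsetP aI; exact: chain_decreasing.
Qed.

(** Every member of a chain is contained in [I_0], the set of simple reflections, so it
can be recovered from its simple roots. *)
Lemma chain_levelE I k : is_chain dot Pi I -> (k <= n)%N ->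
  [set` I (inord k)] = [set s_ a | a in level I k].
Proof.
move=> cI kn; apply/seteqP; split=> [g /= gI|_ [a [aPi aI] <-]//].
have : g \in I (inord 0) by apply: fsubsetP gI; apply: chain_decreasing.
have [I0 _] := cI.
rewrite (_ : inord 0 = ord0) ?I0; last by apply: val_inj; rewrite /= inordK.
by move=> /imfsetP[a /= aPi ga]; exists a => //; split=> //; rewrite -ga.
Qed.

Lemma parabolic_levelE I : is_chain dot Pi I ->
  parabolic (I ord_max) = words dot (level I n).
Proof.
move=> cI; rewrite -generated_group_words -chain_levelE//.
by congr (parabolic (I _)); apply: val_inj; rewrite /= inordK.
Qed.

Lemma chain_eq I J : is_chain dot Pi I -> is_chain dot Pi J ->
  (forall k, (k <= n)%N -> level I k = level J k) -> I = J.
Proof.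
move=> cI cJ IJ; apply/funext => k; apply/fsetP => g.
have kn : (k <= n)%N by rewrite -ltnS.
have : [set` I (inord k)] = [set` J (inord k)].
  by rewrite !chain_levelE// IJ.
rewrite inord_val => /seteqP[IJk JIk].
by apply/idP/idP; [exact: IJk|exact: JIk].
Qed.

Lemma stratum_level_orthogonal I v k (i : 'I_n) a : is_chain dot Pi I -> X I v ->
  (i < k <= n)%N -> level I k a -> dot (v i) a = 0.
Proof.
move=> cI /chain_stratumP/(_ i)[v0 _] ikn /(level_sub cI ikn); exact: v0.
Qed.

Lemma stratum_dominant I v (i : 'I_n) : X I v -> dominant dot (level I i) (v i).
Proof.
move=> /chain_stratumP/(_ i)[v0 v_gt0] a aI.
have [/v0->//|/(v_gt0 _ aI)/ltW//] := pselect (level I i.+1 a).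
Qed.

Lemma stratum_next_level I v (i : 'I_n) : is_chain dot Pi I -> X I v ->
  level I i.+1 = [set a | level I i a /\ dot (v i) a = 0].
Proof.
move=> cI /chain_stratumP/(_ i)[v0 v_gt0]; apply/seteqP; split=> a.
  by move=> aI; split; [apply: level_sub aI; rewrite // leqnSn/=|exact: v0].
move=> [aI va]; apply: contrapT => /(v_gt0 _ aI).
by rewrite va ltxx.
Qed.

(** By induction on [k]: the vector [v_k] is dominant for level [k], which supports [b].
So [dot (v_k) b] is a sum of nonnegative terms and its vanishing kills all the terms,
whereas a simple root of level [k] outside level [k+1] would contribute a positive
one. *)
Lemma positive_support I v k b : is_chain dot Pi I -> X I v -> (k <= n)%N ->
  P b -> (forall i : 'I_n, (i < k)%N -> dot (v i) b = 0) ->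
  forall a, a \in Pi -> dot (coweight dot Pi a) b != 0 -> level I k a.
Proof.
move=> cI Xv + Pb; elim: k => [|k IH] kn vb a aPi a0.
  by rewrite level0.
have {}IH := IH (ltnW kn) (fun i ik => vb i (ltnW ik)).
pose i := Ordinal kn; rewrite -[k]/(val i) (stratum_next_level i cI Xv).
have aI := IH a aPi a0; split=> //; apply/eqP; move: (vb i (leqnn _)) => /eqP.
apply: contraTT => va; have [bPhi _] := Pb.
rewrite (dot_root_expansion dot Pi_simple _ bPhi) (big_fsetD1 a aPi)/=.
apply: lt0r_neq0.
rewrite ltr_wpDr//.
  rewrite big_seq sumr_ge0// => c /fsetD1P[ca cPi].
  have [->|c0] := eqVneq (dot (coweight dot Pi c) b) 0; first by rewrite mul0r.
  rewrite mulr_ge0 ?(positive_coef_ge0 dot Pi_simple)//.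
  by apply: (stratum_dominant (i := i) Xv); exact: IH.
rewrite mulr_gt0// lt_neqAle.
  by rewrite eq_sym a0 (positive_coef_ge0 dot Pi_simple).
by rewrite eq_sym va (stratum_dominant (i := i) Xv).
Qed.

(** A reflection fixes a vector exactly when its root is orthogonal to it; this turns
the chambers of the stabilisers into conditions on inner products. *)
Lemma roots_of_stab_upto v m b : b \in Phi ->
  stab_upto dot Phi v m (s_ b) <->
  (forall i : 'I_n, (i < m)%N -> dot (v i) b = 0).
Proof.
move=> bPhi.
have Wb : W (s_ b) by apply: sub_gen_smallest; exists b.
split=> [[_ sb] i im|vb].
  have [_] := sb i im; apply: (reflection_fixP (root_neq0 Phi_root bPhi)).
by split=> // i im; split=> //; rewrite reflection_id ?vb.
Qed.

Lemma iterated_chamberP v : iterated_chamber dot Phi Pi v <->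
  forall (m : 'I_n) b, P b ->
    (forall i : 'I_n, (i < m)%N -> dot (v i) b = 0) -> 0 <= dot (v m) b.
Proof.
split=> Cv m b.
  move=> Pb vb; have [bPhi _] := Pb.
  by apply: (Cv m); split=> //; split=> //; apply/roots_of_stab_upto.
by move=> [[bPhi /(roots_of_stab_upto _ _ bPhi) vb] Pb]; exact: Cv.
Qed.

Lemma stratum_sub_chamber I : is_chain dot Pi I ->
  X I `<=` iterated_chamber dot Phi Pi (n := n).
Proof.
move=> cI v Xv; apply/iterated_chamberP => m b Pb vb.
apply: (dominant_positive Pi_simple Pb) => a aPi a0.
apply: (stratum_dominant Xv); apply: (positive_support cI Xv _ Pb vb) => //.
exact: ltnW.
Qed.

(** The chain of the stratum through [v], for [v] in the iterated chamber: [I_k]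
collects the simple reflections fixing the first [k] coordinates. *)
Definition fixing_chain v : 'I_n.+1 -> {fset 'End(V)} := fun k =>
  [fset g in simple_reflections dot Pi |
     [forall i : 'I_n, (i < k)%N ==> (g (v i) == v i)]]%fset.

Lemma fixing_chainP v : is_chain dot Pi (fixing_chain v).
Proof.
split=> [|i].
  by apply/fsetP => g; rewrite !inE andbC; case: forallP => // -[].
apply/fsubsetP => g; rewrite !inE => /andP[-> /= /forallP gv].
apply/forallP => j; apply/implyP => ji; apply: (implyP (gv j)).
by rewrite /= /bump add1n ltnW.
Qed.

Lemma level_fixing_chain v k : (k <= n)%N -> level (fixing_chain v) k =
  [set a | a \in Pi /\ forall i : 'I_n, (i < k)%N -> dot (v i) a = 0].
Proof.
move=> kn; apply/seteqP; split=> a [aPi].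
  rewrite !inE inordK// => /andP[_ /forallP av]; split=> // i ik.
  apply: reflection_fixP; last exact/eqP/(implyP (av i)).
  exact/(root_neq0 Phi_root)/(simple_root Pi_simple).
move=> va; split=> //; rewrite !inE inordK//; apply/andP; split.
  by apply/imfsetP; exists a.
by apply/forallP => i; apply/implyP => ik; rewrite reflection_id ?va.
Qed.

(** Only simple roots are tested here; together with [stratum_sub_chamber] this shows
that they suffice to define the iterated chamber. *)
Lemma exists_stratum v :
  (forall (m : 'I_n) a, a \in Pi ->
    (forall i : 'I_n, (i < m)%N -> dot (v i) a = 0) -> 0 <= dot (v m) a) ->
  X (fixing_chain v) v.
Proof.
move=> Cv; apply/chain_stratumP => i.
rewrite !level_fixing_chain//; last exact: ltnW.
split=> a [aPi va]; first exact: va.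
move=> nva; rewrite lt_neqAle Cv// andbT eq_sym; apply/negP => /eqP via.
apply: nva; split=> // j; rewrite ltnS leq_eqVlt => /orP[|]; last exact: va.
by move=> /eqP/val_inj ->.
Qed.

(** Once the first [k] coordinates are in place, the next one is made dominant by an
element of the parabolic subgroup of the simple roots orthogonal to them, which leaves
them unchanged. *)
Lemma stratum_cover v : exists g I, [/\ W g, is_chain dot Pi I & X I (diag_act g v)].
Proof.
suff H k : (k <= n)%N -> exists2 g, words dot [set` Pi] g &
    forall (m : 'I_n), (m < k)%N -> forall a, a \in Pi ->
    (forall i : 'I_n, (i < m)%N -> dot (g (v i)) a = 0) -> 0 <= dot (g (v m)) a.
  have [g Wg Cgv] := H n (leqnn n).
  exists g, (fixing_chain (diag_act g v)); split; last 2 first.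
  - exact: fixing_chainP.
  - by apply: exists_stratum => m; exact: Cgv.
  by rewrite (reflection_groupE Phi_root Pi_simple).
elim: k => [|k IH] kn; first by exists \1%VF; first exact: words_id.
have [g Wg Cgv] := IH (ltnW kn); pose j := Ordinal kn.
pose J := [set a | a \in Pi /\ forall i : 'I_n, (i < k)%N -> dot (g (v i)) a = 0].
have JPi : J `<=` [set` Pi] by move=> a [].
have [h Jh Jdom] := exists_dominant Phi_root Pi_simple (g (v j)) JPi.
exists (h \o g)%VF; first by apply: words_mul => //; exact: words_sub Jh.
have hgv (i : 'I_n) : (i < k)%N -> h (g (v i)) = g (v i).
  by move=> ik; apply: (words_fix Jh) => a [_]; exact.
move=> m; rewrite ltnS leq_eqVlt => /orP[/eqP mk|mk] a aPi va.
  have -> : m = j by exact: val_inj.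
  rewrite comp_lfunE; apply: Jdom; split=> // i ik.
  by rewrite -hgv// -comp_lfunE va// mk.
rewrite comp_lfunE hgv//; apply: Cgv => // i im.
by rewrite -hgv ?(ltn_trans im)// -comp_lfunE va.
Qed.

(** Suppose [u] is in the parabolic subgroup of the common level [i] of the two chains.
Both [y_i] and [x_i = u y_i] are dominant for that level, so [u] lies in the parabolic
subgroup of the simple roots orthogonal to [y_i], that is of the next level; therefore
[x_i = y_i], and the next levels of the two chains agree. *)
Lemma stratum_conjugate I J x y u : is_chain dot Pi I -> is_chain dot Pi J ->
  X I x -> X J y -> W u -> x = diag_act u y ->
  I = J /\ words dot (level I n) u.
Proof.
rewrite (reflection_groupE Phi_root Pi_simple) => cI cJ Xx Xy Wu xuy.
suff H k : (k <= n)%N ->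
    (forall j, (j <= k)%N -> level I j = level J j) /\ words dot (level I k) u.
  by have [IJ Iu] := H n (leqnn n); split=> //; exact: chain_eq.
elim: k => [|k IH] kn.
  by split=> [j|]; [rewrite leqn0 => /eqP->|]; rewrite !level0.
have [IJ Iu] := IH (ltnW kn); pose i := Ordinal kn.
have IJi : level I i = level J i by exact: IJ.
have xi : x i = u (y i) by rewrite xuy.
have yI : words dot (level J i.+1) u.
  rewrite (stratum_next_level i cJ Xy) -IJi.
  apply: (dominant_conjugate Phi_root Pi_simple (@level_simple I i) Iu).
    by rewrite IJi; exact: stratum_dominant.
  by rewrite -xi; exact: stratum_dominant.
have xy : x i = y i.
  rewrite xi; apply: (words_fix yI) => a.
  by move=> /(stratum_level_orthogonal cJ Xy); apply; rewrite ltnSn.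
have IJS : level I i.+1 = level J i.+1.
  by rewrite (stratum_next_level i cJ Xy) (stratum_next_level i cI Xx) IJi xy.
split=> [j|]; last by rewrite -[k]/(val i) IJS.
by rewrite leq_eqVlt => /predU1P[->//|/IJ].
Qed.

Lemma stratum_fixed I x u : is_chain dot Pi I -> X I x ->
  words dot (level I n) u -> diag_act u x = x.
Proof.
move=> cI Xx Iu; apply/funext => i; apply: (words_fix Iu) => a.
by move=> /(stratum_level_orthogonal cI Xx); apply; rewrite ltn_ord leqnn.
Qed.

(** Sums of coweights take prescribed values on the simple roots. *)
Lemma stratum_nonempty I : X I !=set0.
Proof.
(* [c i b] is 1 if [b] lies outside level [i+1], and 0 otherwise. *)
pose c (i : 'I_n) b : R := (s_ b \notin I (inord i.+1))%:R.
exists (fun i => \sum_(b <- Pi) c i b *: coweight dot Pi b).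
have dotE (i : 'I_n) a : a \in Pi ->
    dot (\sum_(b <- Pi) c i b *: coweight dot Pi b) a = c i a.
  move=> aPi; rewrite linear_sumlz (big_fsetD1 a)//= dotZl.
  rewrite (dot_coweight dot Pi_simple aPi aPi) eqxx mulr1 big_seq big1 ?addr0// => b.
  move=> /fsetD1P[ba bPi]; rewrite dotZl (dot_coweight dot Pi_simple aPi bPi).
  by rewrite eq_sym (negbTE ba) mulr0.
apply/chain_stratumP => i; split=> a [aPi aI].
  by rewrite dotE// /c aI.
by move=> naI; rewrite dotE// /c; case: (boolP (_ \in _)) => // aI'; case: naI.
Qed.

End Strata.

(** * Closures of strata *)

Section PowerClosure.
Context {R : realType} {V : vectType R} (dot : {dot V for (@idfun R)}).
Variable n : nat.
Implicit Types (A : set ('I_n -> V)) (v x : 'I_n -> V).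

Lemma power_closureP A v : power_closure dot A v <->
  forall e, 0 < e -> exists2 x, A x & forall i, edist dot (v i) (x i) < e.
Proof.
split=> [Av e e0|Av B vB].
  have [|x [Ax xv]] := Av [set x | forall i, edist dot (v i) (x i) < e].
    apply: (@filter_forall _ _ (fun i => [set x | edist dot (v i) (x i) < e])
      _ (nbhs_filter (v : {ptws 'I_n -> euclidean dot}))) => i.
    apply: (@proj_continuous _ (fun=> euclidean dot) i v
      [set y | edist dot (v i) y < e]).
    exact: (@nbhsx_ballx _ (euclidean dot) (v i) _ e0).
  by exists x.
(* It suffices that the filter of uniform neighbourhoods of [v] is finer than the
   neighbourhood filter of the product topology. *)
pose F := filter_from [set e : R | 0 < e]
  (fun e => [set x : 'I_n -> V | forall i, edist dot (v i) (x i) < e]).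
have FF : Filter F.
  apply: filter_from_filter; first by exists 1; exact: ltr01.
  move=> e f /= e0 f0; exists (Num.min e f); first by rewrite /= lt_min e0.
  move=> x /= xv; split=> i; have := xv i; rewrite lt_min => /andP[]//.
have Fv : F --> (v : {ptws 'I_n -> euclidean dot}).
  apply/cvg_sup => i B' /= [C [[D oD DC] Cv CB']].
  move: Cv; rewrite -DC /= => Dv.
  have /(nbhs_ballP (v i : euclidean dot) D)[e /= e0 eD] : nbhs (v i : euclidean dot) D.
    exact: open_nbhs_nbhs.
  exists e => // x xv; apply: CB'; rewrite -DC; apply: eD; exact: xv.
have [e /= e0 eB] := Fv B vB.
by have [x Ax xv] := Av e e0; exists x; split=> //; exact: eB.
Qed.

(** Closed half-spaces are closed, by the Cauchy-Schwarz inequality. *)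
Lemma power_closure_dot_ge0 A v (i : 'I_n) b : power_closure dot A v ->
  (forall x, A x -> 0 <= dot (x i) b) -> 0 <= dot (v i) b.
Proof.
move=> /power_closureP Av Ab; rewrite leNgt; apply/negP => vb.
(* The added 1 keeps the divisor positive even when [b = 0]. *)
pose N := dot b b + 1; have N1 : 1 <= N by rewrite lerDr dot_ge0.
have N0 : 0 < N by apply: lt_le_trans N1.
have [|x Ax /(_ i) vx] := Av (- dot (v i) b / N).
  by rewrite divr_gt0// oppr_gt0.
have := dot_CauchySchwarz dot (x i - v i) b; apply/negP; rewrite -ltNge.
move: vx; rewrite edistC /edist.
set q := dot (x i - v i) (x i - v i); set d := dot (v i) b in vb *.
have q0 : 0 <= q by exact: dot_ge0.
move=> qd; have {}qd : q < (- d / N) ^+ 2.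
  rewrite -(sqr_sqrtr q0) ltr_pXn2r// ?nnegrE ?sqrtr_ge0//.
  by rewrite divr_ge0 ?ltW// oppr_gt0.
have xb := Ab x Ax.
apply: (@le_lt_trans _ _ (q * N)); first by rewrite ler_wpM2l// lerDl.
apply: (@lt_le_trans _ _ ((- d / N) ^+ 2 * N)); first by rewrite ltr_pM2r.
have -> : (- d / N) ^+ 2 * N = d ^+ 2 / N by field; rewrite gt_eqF.
apply: (@le_trans _ _ (d ^+ 2)); first by rewrite ler_pdivrMr// ler_peMr// sqr_ge0.
rewrite -sqrrN ler_pXn2r ?nnegrE ?oppr_ge0 ?(ltW vb)//.
  by rewrite dotBl -/d lerDr.
by rewrite dotBl -/d addr_ge0// oppr_ge0 ltW.
Qed.

Lemma power_closure_dot_eq0 A v (i : 'I_n) b : power_closure dot A v ->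
  (forall x, A x -> dot (x i) b = 0) -> dot (v i) b = 0.
Proof.
move=> Av Ab; apply/eqP; rewrite eq_le.
rewrite (power_closure_dot_ge0 Av) => [|x /Ab->//].
rewrite -oppr_ge0 -dotNr (power_closure_dot_ge0 Av)// => x /Ab.
by rewrite dotNr => ->; rewrite oppr0.
Qed.

End PowerClosure.

Section StratumClosure.
Context {R : realType} {V : vectType R} (dot : {dot V for (@idfun R)}).
Variables (Phi Pi : {fset V}).
Hypothesis Phi_root : is_root_system dot Phi.
Hypothesis Pi_simple : is_simple_system Phi Pi.
Variable n : nat.
Implicit Types (a b : V) (g w : 'End(V)).
Implicit Types (I J : 'I_n.+1 -> {fset 'End(V)}) (v x y : 'I_n -> V).

Local Notation s_ := (reflection dot).
Local Notation P := (positive_roots Phi Pi).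
Local Notation W := (reflection_group dot Phi).
Local Notation X := (chain_stratum dot Pi).
Local Notation level := (level dot Pi).

(** The closure of [X_I]: equalities are kept and strict inequalities relaxed. *)
Definition closed_stratum I : set ('I_n -> V) :=
  [set v | forall (i : 'I_n) a,
    (level I i a -> 0 <= dot (v i) a) /\ (level I i.+1 a -> dot (v i) a = 0)].

Lemma stratum_closed I : X I `<=` closed_stratum I.
Proof.
move=> v Xv i a; split; first exact: stratum_dominant.
by have [+ _] := chain_stratumP dot Pi I v; move=> /(_ Xv i)[+ _]; apply.
Qed.

(** The conditions defining [closed_stratum] are closed and [w] is an isometry.
Conversely, if [v] satisfies them and [p] is in [X_I], then [v + t p] is in [X_I] for
all [t > 0], and it tends to [v] as [t] tends to [0]. *)
Lemma closure_stratum I w : W w ->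
  power_closure dot (diag_act w @` X I) = diag_act w @` closed_stratum I.
Proof.
rewrite (reflection_groupE Phi_root Pi_simple) => Ww.
apply/seteqP; split=> [v Av|_ [v Zv <-]].
  exists (diag_act w^-1%VF v); last first.
    by apply/funext => i; rewrite /diag_act (wordsVK Ww).
  move=> i a; have wa : dot (w^-1%VF (v i)) a = dot (v i) (w a).
    by rewrite -(dot_words _ a Ww) (wordsVK Ww).
  split=> Ia; rewrite /diag_act wa.
    apply: (power_closure_dot_ge0 Av) => _ [x /stratum_closed/(_ i a)[xa _] <-].
    by rewrite /diag_act (dot_words _ _ Ww) xa.
  apply: (power_closure_dot_eq0 Av) => _ [x /stratum_closed/(_ i a)[_ xa] <-].
  by rewrite /diag_act (dot_words _ _ Ww) xa.
apply/power_closureP => e e0; have [p Xp] := stratum_nonempty dot Pi_simple I.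
(* The distance from [v] to [v + t p] at coordinate [i] is [t] times the norm of [p i],
   and [M] exceeds all these norms. *)
pose M := 1 + \sum_i edist dot (p i) 0.
have M0 : 0 < M.
  by rewrite ltr_pwDl ?ltr01// sumr_ge0// => i _; exact: sqrtr_ge0.
pose t := e / M; have t0 : 0 < t by rewrite divr_gt0.
exists (diag_act w (fun i => v i + t *: p i)).
  exists (fun i => v i + t *: p i) => //; apply/chain_stratumP => i.
  have /chain_stratumP/(_ i)[p0 p_gt0] := Xp.
  split=> a aI.
    have [_ va] := Zv i a.
    by rewrite linearDl /= dotZl p0// va// mulr0 addr0.
  move=> naI; have [va _] := Zv i a.
  by rewrite linearDl /= dotZl ltr_wpDl ?va// mulr_gt0 ?p_gt0.
move=> i; rewrite /diag_act /edist -linearB (dot_words _ _ Ww).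
rewrite opprD addNKr -scaleNr dotZl dotZr mulrA -expr2 sqrrN.
rewrite sqrtrM ?sqr_ge0// sqrtr_sqr gtr0_norm// -[p i]subr0 -/(edist dot (p i) 0).
rewrite /t mulrAC ltr_pdivrMr// ltr_pM2l// /M (bigD1 i)//= addrCA ltrDl.
by rewrite ltr_pwDl ?ltr01// sumr_ge0// => j _; exact: sqrtr_ge0.
Qed.

(** If [b] is positive, it is supported on level [i] of [J], for which [y_i] is dominant.
If [- b] is positive, then [dot (x_i) b] is both nonnegative and nonpositive, hence
zero, so that [- b] is supported on level [i+1], to which [y_i] is orthogonal. *)
Lemma stratum_root_sign J x y (i : 'I_n) b : is_chain dot Pi J -> X J x -> X J y ->
  b \in Phi -> (forall j : 'I_n, (j < i)%N -> dot (x j) b = 0) ->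
  0 <= dot (x i) b -> 0 <= dot (y i) b.
Proof.
move=> cJ Xx Xy bPhi.
have pos z c : X J z -> P c -> (forall j : 'I_n, (j < i)%N -> dot (x j) c = 0) ->
    0 <= dot (z i) c.
  move=> Xz Pc xc; apply: (dominant_positive Pi_simple Pc) => a aPi a0.
  apply: (stratum_dominant Xz).
  exact: (positive_support Pi_simple cJ Xx (ltnW (ltn_ord i)) Pc xc).
case: (root_pos_or_neg Pi_simple bPhi) => Pb xb xib; first exact: (pos y).
have xNb (j : 'I_n) : (j < i)%N -> dot (x j) (- b) = 0.
  by move=> ji; rewrite dotNr xb// oppr0.
have xi0 : dot (x i) b = 0.
  by apply/eqP; rewrite eq_le xib -oppr_ge0 -dotNr pos.
have xNbS (j : 'I_n) : (j < i.+1)%N -> dot (x j) (- b) = 0.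
  rewrite ltnS leq_eqVlt => /orP[/eqP/val_inj->|/xNb//].
  by rewrite dotNr xi0 oppr0.
have [NbPhi _] := Pb.
rewrite -[b]opprK dotNr (dot_root_expansion dot Pi_simple _ NbPhi).
rewrite big_seq big1 ?oppr0// => a aPi.
have [->|a0] := eqVneq (dot (coweight dot Pi a) (- b)) 0; first by rewrite mul0r.
rewrite (stratum_level_orthogonal cJ Xy (k := i.+1)) ?mulr0//.
  by rewrite ltnSn ltn_ord.
exact: (positive_support Pi_simple cJ Xx (ltn_ord i) Pb xNbS).
Qed.

(** The condition of [closed_stratum I] at coordinate [i] for [a] in [I_i] reads as a sign
condition on the root [u^-1 a] at [x_i].  As [a] also lies in all previous levels, that
root is orthogonal to the previous [x_j], and [stratum_root_sign] applies to it and, for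
the equalities, to its opposite. *)
Lemma closed_stratum_saturated I J x y u : is_chain dot Pi I -> is_chain dot Pi J ->
  W u -> X J x -> X J y ->
  closed_stratum I (diag_act u x) -> closed_stratum I (diag_act u y).
Proof.
rewrite (reflection_groupE Phi_root Pi_simple) => cI cJ Wu Xx Xy Zx i a.
have uE z : dot (u z) a = dot z (u^-1%VF a).
  by rewrite -(dot_words _ (u^-1%VF a) Wu) (wordsVK Wu).
have rootE : level I i a -> u^-1%VF a \in Phi.
  move=> [aPi _]; apply: (root_words Phi_root); last exact: simple_root aPi.
  by apply: words_inv; apply: (words_simple_root Pi_simple).
have xa0 : level I i a -> forall j : 'I_n, (j < i)%N -> dot (x j) (u^-1%VF a) = 0.
  move=> aI j ji; rewrite -uE; have [_] := Zx j a; apply.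
  by apply: level_sub aI => //; rewrite ji ltnW.
have ge0 : level I i a -> 0 <= dot (y i) (u^-1%VF a).
  move=> aI; apply: (stratum_root_sign cJ Xx Xy (rootE aI) (xa0 aI)).
  by rewrite -uE; have [+ _] := Zx i a; apply.
rewrite /diag_act uE; split=> // aIS.
have aI : level I i a by apply: level_sub aIS; rewrite // leqnSn /=.
have [_ /(_ aIS)] := Zx i a; rewrite /diag_act uE => xi0.
apply/eqP; rewrite eq_le ge0// andbT -oppr_ge0 -dotNr.
apply: (stratum_root_sign cJ Xx Xy (root_opp Phi_root (rootE aI))) => [j ji|].
  by rewrite dotNr xa0// oppr0.
by rewrite dotNr xi0 oppr0.
Qed.

End StratumClosure.

Theorem theorem3p4 (R : realType) (V : vectType R)
    (dot : {dot V for (@idfun R)}) (Phi Pi : {fset V})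
    (Phi_root : is_root_system dot Phi)
    (Pi_simple : is_simple_system Phi Pi)
    (n : nat) (n_ge1 : (1 <= n)%N) :
  let W := reflection_group dot Phi in
  let chain (I : 'I_n.+1 -> {fset 'End(V)}) : Prop := is_chain dot Pi I in
  let X (I : 'I_n.+1 -> {fset 'End(V)}) : set ('I_n -> V) :=
    chain_stratum dot Pi I in
  let C : set ('I_n -> V) := iterated_chamber dot Phi Pi (n := n) in
  (* (a) *)
  (forall I, chain I -> X I `<=` C) /\
  (* (b) *)
  (forall I w v, chain I -> W w -> (diag_act w @` X I) v ->
     diag_stabiliser W v = conjugate w (parabolic (I ord_max))) /\
  (* (c) *)
  (forall v w I J, W v -> W w -> chain I -> chain J ->
     ((diag_act v @` X I) `&` (diag_act w @` X J) !=set0 <->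
      diag_act v @` X I = diag_act w @` X J) /\
     (diag_act v @` X I = diag_act w @` X J <->
      I = J /\ parabolic (I ord_max) (v^-1 \o w)%VF)) /\
  (* (d) *)
  (forall I w, chain I -> W w ->
     setwise_stabiliser W (diag_act w @` X I) =
     conjugate w (parabolic (I ord_max))) /\
  (* (e) *)
  (disjoint_union_of_strata dot Phi Pi C /\
   disjoint_union_of_strata dot Phi Pi [set: 'I_n -> V]) /\
  (* (f) *)
  (forall A : set ('I_n -> V), strata dot Phi Pi A ->
     exists2 D : set (set ('I_n -> V)), D `<=` strata dot Phi Pi (n := n) &
       power_closure dot A = \bigcup_(B in D) B).
Proof.
move=> W chain X C.
have WE : W = words dot [set` Pi] := reflection_groupE Phi_root Pi_simple.
have WM g h : W g -> W h -> W (g \o h)%VF by rewrite WE; exact: words_mul.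
have WV g : W g -> W g^-1%VF by rewrite WE; exact: words_inv.
have WK g : W g -> cancel g g^-1%VF by rewrite WE; exact: wordsK.
have WVK g : W g -> cancel g^-1%VF g by rewrite WE; exact: wordsVK.
have diagM g h (v : 'I_n -> V) : diag_act (g \o h)%VF v = diag_act g (diag_act h v).
  by apply/funext => i; rewrite /diag_act comp_lfunE.
have diagK g (v : 'I_n -> V) : W g -> diag_act g^-1%VF (diag_act g v) = v.
  by move=> Wg; apply/funext => i; rewrite /diag_act WK.
have diagVK g (v : 'I_n -> V) : W g -> diag_act g (diag_act g^-1%VF v) = v.
  by move=> Wg; apply/funext => i; rewrite /diag_act WVK.
have parE I : chain I -> parabolic (I ord_max) = words dot (level dot Pi I n).
  exact: parabolic_levelE.
have parW I g : chain I -> parabolic (I ord_max) g -> W g.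
  by move=> cI; rewrite parE// WE; apply: words_sub; exact: level_simple.
have conjE I w g : chain I -> W w ->
    conjugate w (parabolic (I ord_max)) g <->
    W g /\ parabolic (I ord_max) (w^-1 \o (g \o w))%VF.
  move=> cI Ww; split=> [[h Ih <-]|[Wg Ig]].
    have Wh := parW I h cI Ih; split; first exact: WM _ _ (WM _ _ Ww Wh) (WV _ Ww).
    suff -> : (w^-1 \o (w \o h \o w^-1 \o w))%VF = h by [].
    by apply/lfunP => z; rewrite !comp_lfunE !WK.
  exists (w^-1 \o (g \o w))%VF => //.
  by apply/lfunP => z; rewrite !comp_lfunE !WVK.
have meet_iii v w I J : W v -> W w -> chain I -> chain J ->
    (diag_act v @` X I) `&` (diag_act w @` X J) !=set0 ->
    I = J /\ parabolic (I ord_max) (v^-1 \o w)%VF.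
  move=> Wv Ww cI cJ [_ [[x Xx <-] [y Xy yx]]]; rewrite parE//.
  apply: (stratum_conjugate Phi_root Pi_simple cI cJ Xx Xy).
    by apply: WM => //; exact: WV.
  by rewrite diagM yx diagK.
have iii_eq v w I J : W v -> W w -> chain I ->
    I = J /\ parabolic (I ord_max) (v^-1 \o w)%VF ->
    diag_act v @` X I = diag_act w @` X J.
  move=> Wv Ww cI [<-]; rewrite parE// => Ivw.
  have fixX x : X I x -> diag_act w x = diag_act v x.
    move=> Xx; rewrite -[in RHS](stratum_fixed cI Xx Ivw) diagM diagVK//.
  by apply/seteqP; split=> _ [x Xx <-]; exists x => //; rewrite fixX.
have eq_meet v w I J : diag_act v @` X I = diag_act w @` X J ->
    (diag_act v @` X I) `&` (diag_act w @` X J) !=set0.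
  move=> <-; rewrite setIid; have [x Xx] := stratum_nonempty dot Pi_simple I.
  by exists (diag_act v x); exists x.
have partC v w I J : W v -> W w -> chain I -> chain J ->
    ((diag_act v @` X I) `&` (diag_act w @` X J) !=set0 <->
     diag_act v @` X I = diag_act w @` X J) /\
    (diag_act v @` X I = diag_act w @` X J <->
     I = J /\ parabolic (I ord_max) (v^-1 \o w)%VF).
  move=> Wv Ww cI cJ; split; split=> H.
  - by apply: iii_eq => //; exact: meet_iii.
  - exact: eq_meet.
  - by apply: meet_iii => //; exact: eq_meet.
  - exact: iii_eq.
have partA I : chain I -> X I `<=` C.
  exact: (stratum_sub_chamber Phi_root Pi_simple).
have triv (D : set (set ('I_n -> V))) :
    D `<=` strata dot Phi Pi (n := n) -> trivIset D id.
  move=> DS A B /DS[v [I [Wv cI ->]]] /DS[w [J [Ww cJ ->]]].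
  by case: (partC v w I J Wv Ww cI cJ) => -[H _] _; exact: H.
split; first exact: partA.
split.
  move=> I w _ cI Ww [x Xx <-]; apply/seteqP; split=> g.
    move=> [Wg gx]; apply/(conjE _ _ _ cI Ww); split=> //.
    have Wwgw : W (w^-1 \o (g \o w))%VF := WM _ _ (WV _ Ww) (WM _ _ Wg Ww).
    rewrite parE//.
    apply: (stratum_conjugate Phi_root Pi_simple cI cI Xx Xx Wwgw _).2.
    by rewrite !diagM gx diagK.
  move=> /(conjE _ _ _ cI Ww)[Wg]; rewrite parE// => Ig; split=> //.
  have := stratum_fixed cI Xx Ig; rewrite !diagM => gx.
  by rewrite -[in RHS]gx diagVK.
split; first exact: partC.
have diag_image g w I : diag_act g @` (diag_act w @` X I) =
    diag_act (g \o w)%VF @` X I.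
  by rewrite image_comp; congr (_ @` _); apply/funext => x; rewrite /= diagM.
split.
  move=> I w cI Ww; apply/seteqP; split=> g.
    move=> [Wg gX]; apply/(conjE _ _ _ cI Ww); split=> //.
    rewrite diag_image in gX.
    by have [_ [+ _]] := partC w (g \o w)%VF I I Ww (WM _ _ Wg Ww) cI cI; case.
  move=> /(conjE _ _ _ cI Ww)[Wg Ig]; split=> //; rewrite diag_image.
  by apply/esym/iii_eq => //; exact: WM.
have cover v : exists2 A, strata dot Phi Pi (n := n) A & A v.
  have [g [I [Wg cI Xgv]]] := stratum_cover Phi_root Pi_simple v.
  exists (diag_act g^-1%VF @` X I); last by exists (diag_act g v); rewrite ?diagK.
  by exists g^-1%VF, I; split=> //; exact: WV.
split; first split.
- split; last by apply: triv => A [].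
  apply/seteqP; split=> [v Cv|v [A [_ AC] /AC//]].
  have Xv : X (fixing_chain dot Pi v) v.
    apply: (exists_stratum Phi_root Pi_simple) => m a aPi va.
    move/(iterated_chamberP Pi Phi_root): Cv; apply => //.
    exact: (simple_positive dot).
  have cv := fixing_chainP dot Pi v.
  exists (X (fixing_chain dot Pi v)) => //; split; last exact: partA.
  exists \1%VF, (fixing_chain dot Pi v); split=> //.
    by rewrite -/W WE; exact: words_id.
  rewrite -[LHS]image_id; congr (_ @` _).
  by apply/funext => x; apply/funext => i; rewrite /diag_act id_lfunE.
- split; last by apply: triv => A [].
  apply/seteqP; split=> // v _; have [A SA Av] := cover v.
  by exists A.
move=> _ [w [I [Ww cI ->]]].
exists [set B | strata dot Phi Pi B /\
  B `<=` power_closure dot (diag_act w @` chain_stratum dot Pi I)]; first by move=> B [].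
apply/seteqP; split=> [v|v [B [_ BA] /BA//]].
have [B SB Bv] := cover v; rewrite (closure_stratum Phi_root Pi_simple I Ww) => -[z Zz zv].
exists B => //; split=> //.
case: SB Bv => g [J [Wg cJ ->]] [x Xx xv] _ [y Xy <-].
exists (diag_act w^-1%VF (diag_act g y)); last exact: diagVK.
rewrite -diagM.
apply: (closed_stratum_saturated Phi_root Pi_simple cI cJ _ Xx Xy).
  by apply: WM => //; exact: WV.
by rewrite diagM xv -zv diagK.
Qed.
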